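(* Let $g=(A,B,v)\in\mathrm{SU}(2)\times\mathbb{R}$ and let $\arg(A)\in(-\pi,\pi]$. Then: 1. If $A=0$, then $d_2(\mathrm{Id},g)=\sqrt{v^2+\pi^2}$. 2. If $|A|=1$, then $d_2(\mathrm{Id},g)=\sqrt{v^2+4|\arg(A)|(2\pi-|\arg(A)|)}$. 3. If $0<|A|<1$ and $\mathrm{Re}(A)=|A|\sin\bigl(\tfrac{\pi}{2}|A|\bigr)$, then $d_2(\mathrm{Id},g)=\sqrt{v^2+\pi^2(1-|A|^2)}$. 4. If $0<|A|<1$ and $\mathrm{Re}(A)>|A|\sin\bigl(\tfrac{\pi}{2}|A|\bigr)$, then $$d_2(\mathrm{Id},g)=\sqrt{v^2+\frac{4}{1+\xi^2}\Bigl(\sin^{-1}\sqrt{(1-|A|^2)(1+\xi^2)}\Bigr)^2},$$ where $\xi$ is the unique solution of the system $$\cos\Bigl(-\tfrac{\xi}{\sqrt{1+\xi^2}}\sin^{-1}\sqrt{(1-|A|^2)(1+\xi^2)}+\sin^{-1}\tfrac{\xi\sqrt{1-|A|^2}}{|A|}\Bigr)=\tfrac{\mathrm{Re}(A)}{|A|},$$ $$\sin\Bigl(-\tfrac{\xi}{\sqrt{1+\xi^2}}\sin^{-1}\sqrt{(1-|A|^2)(1+\xi^2)}+\sin^{-1}\tfrac{\xi\sqrt{1-|A|^2}}{|A|}\Bigr)=\tfrac{\mathrm{Im}(A)}{|A|}.$$ 5. If $0<|A|<1$ and $\mathrm{Re}(A)<|A|\sin\bigl(\tfrac{\pi}{2}|A|\bigr)$,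 then $$d_2(\mathrm{Id},g)=\sqrt{v^2+\frac{4}{1+\xi^2}\Bigl(\pi-\sin^{-1}\sqrt{(1-|A|^2)(1+\xi^2)}\Bigr)^2},$$ where $\xi$ is the unique solution of the system $$\cos\Bigl(\tfrac{\xi}{\sqrt{1+\xi^2}}\bigl(\pi-\sin^{-1}\sqrt{(1-|A|^2)(1+\xi^2)}\bigr)+\sin^{-1}\tfrac{\xi\sqrt{1-|A|^2}}{|A|}\Bigr)=-\tfrac{\mathrm{Re}(A)}{|A|},$$ $$\sin\Bigl(\tfrac{\xi}{\sqrt{1+\xi^2}}\bigl(\pi-\sin^{-1}\sqrt{(1-|A|^2)(1+\xi^2)}\bigr)+\sin^{-1}\tfrac{\xi\sqrt{1-|A|^2}}{|A|}\Bigr)=\tfrac{\mathrm{Im}(A)}{|A|}.$$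
   Context: $\mathrm{SU}(2)\times\mathbb{R}$ is the group of matrices $(A,B,v)=\begin{pmatrix}A&B&0\\-\overline{B}&\overline{A}&0\\0&0&e^v\end{pmatrix}$, $A,B\in\mathbb{C}$, $|A|^2+|B|^2=1$, $v\in\mathbb{R}$, with identity $\mathrm{Id}$. Let $E_1=\tfrac12(e_{12}-e_{21})$, $E_2=\tfrac{i}{2}(e_{12}+e_{21})$, $E_4=e_{33}$ ($e_{jk}$ the $3\times3$ matrix units). $d_2$ is the left-invariant sub-Riemannian metric defined by the left-invariant distribution with value $\mathrm{span}(E_1,E_4,E_2)$ at $\mathrm{Id}$ and the inner product for which $E_1,E_4,E_2$ are orthonormal. *)

(* Defs.v *)
From Stdlib Require Import Reals.
From Coquelicot Require Import Coquelicot.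
Open Scope R_scope.

Definition in_G (A B : C) (v : R) : Prop := Cmod A ^ 2 + Cmod B ^ 2 = 1.

Definition elt (A B : C) (v : R) (i j : nat) : C :=
  match i, j with
  | 0, 0 => A
  | 0, 1 => B
  | 1, 0 => Copp (Cconj B)
  | 1, 1 => Cconj A
  | 2, 2 => RtoC (exp v)
  | _, _ => RtoC 0
  end.

(* Left-invariant horizontal direction u1 E1 + u4 E4 + u2 E2, with
   E1 = (e12 - e21)/2, E2 = i (e12 + e21)/2, E4 = e33. *)
Definition hor (u1 u4 u2 : R) (i j : nat) : C :=
  match i, j with
  | 0, 1 => (u1 / 2, u2 / 2)
  | 1, 0 => (- u1 / 2, u2 / 2)
  | 2, 2 => RtoC u4
  | _, _ => RtoC 0
  end.

Definition mat3mul (M N : nat -> nat -> C) (i j : nat) : C :=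
  Cplus (Cplus (Cmult (M i 0%nat) (N 0%nat j)) (Cmult (M i 1%nat) (N 1%nat j)))
        (Cmult (M i 2%nat) (N 2%nat j)).

(* An admissible (horizontal) curve t |-> (a t, b t, v t) in SU(2) x R with
   continuous controls u1,u4,u2 (coordinates w.r.t. the orthonormal frame
   E1,E4,E2), solving gamma'(t) = gamma(t) (u1 E1 + u4 E4 + u2 E2)
   (derivative taken entrywise, real and imaginary parts), from Id at t=0
   to (A,B,w) at t=1. *)
Definition admissible (a b : R -> C) (v : R -> R) (u1 u4 u2 : R -> R)
  (A B : C) (w : R) : Prop :=
  (forall t, in_G (a t) (b t) (v t)) /\
  (forall t, continuous u1 t /\ continuous u4 t /\ continuous u2 t) /\
  (forall t (i j : nat), (i < 3)%nat -> (j < 3)%nat ->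
     is_derive (fun s => Re (elt (a s) (b s) (v s) i j)) t
       (Re (mat3mul (elt (a t) (b t) (v t)) (hor (u1 t) (u4 t) (u2 t)) i j)) /\
     is_derive (fun s => Im (elt (a s) (b s) (v s) i j)) t
       (Im (mat3mul (elt (a t) (b t) (v t)) (hor (u1 t) (u4 t) (u2 t)) i j))) /\
  a 0 = RtoC 1 /\ b 0 = RtoC 0 /\ v 0 = 0 /\
  a 1 = A /\ b 1 = B /\ v 1 = w.

Definition sr_length (u1 u4 u2 : R -> R) : R :=
  RInt (fun t => sqrt (u1 t ^ 2 + u4 t ^ 2 + u2 t ^ 2)) 0 1.

Definition d2_from_Id (A B : C) (w : R) : Rbar :=
  Glb_Rbar (fun L => exists a b v u1 u4 u2,
    admissible a b v u1 u4 u2 A B w /\ L = sr_length u1 u4 u2).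

Definition carg (z : C) : R :=
  if Rle_dec 0 (Im z) then acos (Re z / Cmod z) else - acos (Re z / Cmod z).

(* Systems defining xi in cases 4 and 5; the domain condition ensures that
   the arguments of asin lie in [-1,1]. *)
Definition xi_dom (A : C) (xi : R) : Prop :=
  xi ^ 2 * (1 - Cmod A ^ 2) <= Cmod A ^ 2.

Definition S (A : C) (xi : R) : R := asin (sqrt ((1 - Cmod A ^ 2) * (1 + xi ^ 2))).
Definition T (A : C) (xi : R) : R := asin (xi * sqrt (1 - Cmod A ^ 2) / Cmod A).

Definition sys4 (A : C) (xi : R) : Prop :=
  xi_dom A xi /\
  cos (- (xi / sqrt (1 + xi ^ 2)) * S A xi + T A xi) = Re A / Cmod A /\
  sin (- (xi / sqrt (1 + xi ^ 2)) * S A xi + T A xi) = Im A / Cmod A.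

Definition sys5 (A : C) (xi : R) : Prop :=
  xi_dom A xi /\
  cos ((xi / sqrt (1 + xi ^ 2)) * (PI - S A xi) + T A xi) = - (Re A / Cmod A) /\
  sin ((xi / sqrt (1 + xi ^ 2)) * (PI - S A xi) + T A xi) = Im A / Cmod A.

(* Main.v *)
Require Import Defs.
From Stdlib Require Import Reals Lra Lia Psatz.
From Coquelicot Require Import Coquelicot.
Open Scope R_scope.

(** Each case exhibits [A] as the endpoint
    [A = exp (- i c th) (cos th + i c sin th)], [c ^ 2 + s ^ 2 = 1],
    [0 <= th <= PI], of a normal geodesic, of length [2 s th] in SU(2); in terms
    of the paper's parameter, [c = xi / sqrt (1 + xi ^ 2)] and
    [s = 1 / sqrt (1 + xi ^ 2)].

    Every such geodesic is minimizing: if a horizontal curve of length [2 l] in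
    SU(2) ends over [A], then right multiplication by a rotation about the vertical
    axis through a phase proportional to arc length, with total phase [q], gives a
    curve of length [sqrt (l ^ 2 + q ^ 2)] on the round unit 3-sphere, so
    [Re (A exp (i q)) >= cos (sqrt (l ^ 2 + q ^ 2))] as long as
    [sqrt (l ^ 2 + q ^ 2) <= PI].  For [q = c th] the left-hand side is [cos th], whence
    [l >= s th].

    Two solutions [xi] for the same [A] therefore give the same distance; since
    [sin x / x] decreases on [(0, PI]] they give the same [th], so that they agree
    up to sign, and the sign can be ambiguous only at [xi = 0].  Existence follows
    from the intermediate value theorem. *)

(** * One-variable calculus and comparison with the cosine *)

Lemma derive_ge0_le (f df : R -> R) :
  (forall t, is_derive f t (df t)) -> (forall t, 0 <= df t) -> f 0 <= f 1.
Proof.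
  intros Hd Hp.
  destruct (MVT_gen f 0 1 df) as [c [_ Hc]].
  - intros x _; apply Hd.
  - intros x _. apply derivable_continuous_pt. exists (df x).
    apply is_derive_Reals, Hd.
  - specialize (Hp c). lra.
Qed.

Lemma is_derive_primitive (f : R -> R) :
  (forall t, continuous f t) -> forall t, is_derive (fun s => RInt f 0 s) t (f t).
Proof.
  intros Hf t. apply is_derive_RInt with 0; [|apply Hf].
  apply filter_forall. intros s. apply RInt_correct, ex_RInt_continuous.
  intros z _; apply Hf.
Qed.

Lemma is_derive_asin (x : R) : -1 < x < 1 -> is_derive asin x (/ sqrt (1 - x ^ 2)).
Proof.
  intros Hx. apply is_derive_Reals.
  replace (/ sqrt (1 - x ^ 2)) with (derive_pt asin x (derivable_pt_asin x Hx)).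
  - unfold derive_pt. exact (proj2_sig (derivable_pt_asin x Hx)).
  - rewrite derive_pt_asin. unfold Rsqr, Rdiv. rewrite Rmult_1_l.
    do 3 f_equal. ring.
Qed.

Lemma continuous_acos (x : R) : -1 < x < 1 -> continuous acos x.
Proof.
  intros Hx. apply continuity_pt_filterlim, derivable_continuous_pt.
  now apply derivable_pt_acos.
Qed.

Lemma continuous_ge0_left (F : R -> R) (a d : R) :
  0 < d -> continuous F a -> (forall x, a - d < x < a -> 0 <= F x) -> 0 <= F a.
Proof.
  intros Hd Hc Hp.
  destruct (Rle_or_lt 0 (F a)) as [|Hn]; [assumption|exfalso].
  apply continuity_pt_filterlim in Hc.
  destruct (Hc (- F a)) as [e [He Hx]]; [lra|].
  assert (Hm : 0 < Rmin e d) by now apply Rmin_pos.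
  pose proof (Rmin_l e d); pose proof (Rmin_r e d).
  set (x := a - Rmin e d / 2).
  specialize (Hp x ltac:(unfold x; lra)).
  specialize (Hx x). simpl in Hx. unfold R_dist, D_x, no_cond in Hx.
  assert (Rabs (F x - F a) < - F a) as H1.
  { apply Hx. split; [split; [exact I|unfold x; lra]|].
    unfold x. rewrite Rabs_left; lra. }
  apply Rabs_def2 in H1. lra.
Qed.

(* [asin x] is not differentiable where [x = 1], in particular at the start;
   the differential inequality is integrated for [asin (l * x)] with
   [l = sin m < 1], and [m] tends to [PI / 2]. *)
Lemma cos_comparison (x dx Th dTh : R -> R) :
  (forall t, is_derive x t (dx t)) -> (forall t, is_derive Th t (dTh t)) ->
  (forall t, 0 <= dTh t) -> (forall t, x t ^ 2 <= 1) ->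
  (forall t, dx t ^ 2 <= dTh t ^ 2 * (1 - x t ^ 2)) ->
  x 0 = 1 -> Th 0 = 0 -> Th 1 <= PI -> cos (Th 1) <= x 1.
Proof.
  intros Hx HTh HdTh Hx1 Hdx Hx0 HTh0 HTh1.
  assert (Hx11 : -1 <= x 1 <= 1) by (specialize (Hx1 1); nra).
  pose proof PI_RGT_0 as HPI.
  destruct (Req_dec (Th 1) PI) as [->|Hne]; [rewrite cos_PI; lra|].
  (* At [m = PI / 2] this is [x 1 - cos (Th 1)]; for smaller [m], [F m >= 0] follows by taking sines
     in [m - Th 1 <= asin (sin m * x 1)]. *)
  set (F := fun m => sin m * x 1 - sin (m - Th 1)).
  assert (HF : 0 <= F (PI / 2)).
  (* The width ensures [m > 0] and [m - Th 1 > - PI / 2], so that sines are compared where [sin]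
     increases; it is positive because [Th 1 = PI] has been set aside. *)
  { apply (continuous_ge0_left F _ (Rmin (PI / 2) (PI - Th 1))).
    - apply Rmin_pos; lra.
    - apply (ex_derive_continuous F). unfold F. auto_derive. trivial.
    - intros m Hm.
      pose proof (Rmin_l (PI / 2) (PI - Th 1)).
      pose proof (Rmin_r (PI / 2) (PI - Th 1)).
      set (l := sin m).
      assert (Hl0 : 0 < l) by (apply sin_gt_0; lra).
      assert (Hl1 : l < 1).
      { rewrite <- sin_PI2. apply sin_increasing_1; lra. }
      assert (Hlx : forall t, -1 < l * x t < 1).
      { intros t. specialize (Hx1 t). assert (-1 <= x t <= 1) by nra. nra. }
      assert (Hmon : asin (l * x 0) + Th 0 <= asin (l * x 1) + Th 1).
      { apply (derive_ge0_le (fun t => asin (l * x t) + Th t)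
          (fun t => l * dx t * / sqrt (1 - (l * x t) ^ 2) + dTh t)).
        - intros t. apply (is_derive_plus (fun t => asin (l * x t)) Th); [|apply HTh].
          apply (is_derive_comp asin (fun t => l * x t)).
          + now apply is_derive_asin.
          + apply (is_derive_scal x), Hx.
        - intros t.
          specialize (Hlx t). specialize (Hdx t). specialize (Hx1 t). specialize (HdTh t).
          assert (Hs2 : 0 < 1 - (l * x t) ^ 2) by nra.
          set (s := sqrt (1 - (l * x t) ^ 2)).
          assert (Hs : 0 < s) by now apply sqrt_lt_R0.
          assert (Hss : s * s = 1 - (l * x t) ^ 2) by (apply sqrt_sqrt; lra).
          (* Shrinking by [l] preserves the inequality: [l ^ 2 * (1 - x ^ 2) <= 1 - (l * x) ^ 2]. *)
          assert (Hb : Rabs (l * dx t) <= Rabs (dTh t * s)).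
          { apply Rsqr_le_abs_0. unfold Rsqr.
            replace (dTh t * s * (dTh t * s)) with (dTh t ^ 2 * (s * s)) by ring.
            rewrite Hss.
            apply Rle_trans with (l ^ 2 * (dTh t ^ 2 * (1 - x t ^ 2))).
            - replace (l * dx t * (l * dx t)) with (l ^ 2 * dx t ^ 2) by ring.
              apply Rmult_le_compat_l; [apply pow2_ge_0|assumption].
            - assert (0 <= dTh t ^ 2 * (1 - l ^ 2)) by
                (apply Rmult_le_pos; [apply pow2_ge_0|nra]).
              nra. }
          rewrite (Rabs_pos_eq (dTh t * s)) in Hb by (apply Rmult_le_pos; lra).
          apply Rabs_le_between in Hb.
          replace (l * dx t * / s + dTh t) with ((l * dx t + dTh t * s) * / s) by
            (field; lra).
          apply Rmult_le_pos; [lra|]. left. now apply Rinv_0_lt_compat. }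
      rewrite Hx0, HTh0, Rmult_1_r in Hmon. unfold l at 1 in Hmon.
      rewrite asin_sin in Hmon by lra.
      specialize (Hlx 1).
      pose proof (asin_bound (l * x 1)) as Hab.
      assert (sin (m - Th 1) <= sin (asin (l * x 1))) as Hfin.
      { assert (0 <= Th 1) by (rewrite <- HTh0; apply (derive_ge0_le Th dTh); auto).
        apply sin_incr_1; lra. }
      rewrite sin_asin in Hfin by lra. unfold F. fold l. lra. }
  unfold F in HF. rewrite sin_PI2 in HF.
  replace (sin (PI / 2 - Th 1)) with (cos (Th 1)) in HF by (symmetry; apply sin_shift).
  lra.
Qed.

(** * Strict decrease of [sin x / x] and of [x cot x] *)

(** The quotient [sin t / t] decreases: the numerator [t * cos t - sin t] of its derivative vanishes
    at 0 and has derivative [- t * sin t]. *)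
Lemma sin_cross_lt (x y : R) : 0 < x < y -> y <= PI -> x * sin y < y * sin x.
Proof.
  intros Hxy Hy.
  destruct (MVT_cor2 (fun t => sin t / t) (fun t => (t * cos t - sin t) / t ^ 2) x y)
    as [c [Heq Hc]]; [lra| |].
  - intros t Ht. apply is_derive_Reals. auto_derive; [lra|]. field. lra.
  - destruct (MVT_cor2 (fun t => t * cos t - sin t) (fun t => - t * sin t) 0 c)
      as [e [Heq' He]]; [lra| |].
    + intros t _. apply is_derive_Reals. auto_derive; trivial. ring.
    + rewrite Rmult_0_l, sin_0, !Rminus_0_r in Heq'.
      assert (Hse : 0 < sin e) by (apply sin_gt_0; lra).
      assert (Hneg : c * cos c - sin c < 0).
      { rewrite Heq'. assert (0 < e * sin e * c) by
          (repeat apply Rmult_lt_0_compat; lra). nra. }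
      assert (0 < - ((c * cos c - sin c) / c ^ 2)).
      { unfold Rdiv. rewrite <- Ropp_mult_distr_l_reverse.
        apply Rdiv_lt_0_compat; [lra|]. apply pow_lt. lra. }
      assert (Hq : sin y / y < sin x / x) by nra.
      apply (Rmult_lt_compat_r (x * y)) in Hq; [|nra].
      replace (sin y / y * (x * y)) with (x * sin y) in Hq by (field; lra).
      replace (sin x / x * (x * y)) with (y * sin x) in Hq by (field; lra).
      exact Hq.
Qed.

(** This is the decrease of [x cot x] on [(0, PI)] without denominators. By the addition formulas it
    amounts to comparing [sin x / x] at [R - q] and [R + q]; if [R + q > PI], the signs of the sines
    suffice. *)
Lemma mul_cos_sin_lt (q R : R) :
  0 < q < R -> R < PI -> R * (cos R * sin q) < q * (cos q * sin R).
Proof.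
  intros Hq HR.
  assert (H : (R - q) * sin (R + q) < (R + q) * sin (R - q)).
  { destruct (Rle_or_lt (R + q) PI) as [H|H].
    - apply sin_cross_lt; lra.
    - assert (0 < sin (R - q)) by (apply sin_gt_0; lra).
      assert (sin (R + q) < 0) by (apply sin_lt_0; lra). nra. }
  rewrite sin_plus, sin_minus in H. lra.
Qed.

(** * Angles and polar form *)

(** The hypothesis on [t] mirrors the definition of [carg], so that the lemma serves both [carg] and
    the bare existence of an angle. *)
Lemma cos_sin_signed_acos (x y t : R) :
  x ^ 2 + y ^ 2 = 1 -> 0 <= y /\ t = acos x \/ y < 0 /\ t = - acos x ->
  Rabs t = acos x /\ cos t = x /\ sin t = y.
Proof.
  intros H Ht. assert (Hx : -1 <= x <= 1) by nra.
  pose proof (acos_bound x).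
  destruct Ht as [[Hy ->]|[Hy ->]].
  - rewrite Rabs_pos_eq, cos_acos, sin_acos by lra.
    split; [reflexivity|]. split; [reflexivity|]. apply sqrt_lem_1; unfold Rsqr; nra.
  - rewrite Rabs_Ropp, Rabs_pos_eq, cos_neg, sin_neg, cos_acos, sin_acos by lra.
    split; [reflexivity|]. split; [reflexivity|].
    replace (1 - Rsqr x) with ((- y) * (- y)) by (unfold Rsqr; nra).
    rewrite sqrt_square; lra.
Qed.

Lemma exists_angle (x y : R) :
  x ^ 2 + y ^ 2 = 1 -> exists t, Rabs t = acos x /\ cos t = x /\ sin t = y.
Proof.
  intros H. destruct (Rle_or_lt 0 y); [exists (acos x)|exists (- acos x)];
    apply cos_sin_signed_acos; auto.
Qed.

Lemma exists_angle_le (x y m : R) : x ^ 2 + y ^ 2 = 1 -> 0 <= m <= PI -> cos m < x ->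
  exists t, - m <= t <= m /\ cos t = x /\ sin t = y.
Proof.
  intros Hxy Hm Hx. assert (Hx1 : -1 <= x <= 1) by nra.
  destruct (exists_angle x y Hxy) as (t & Ht & Hcs).
  exists t. split; [|exact Hcs]. apply Rabs_le_between. rewrite Ht.
  destruct (Rle_or_lt (acos x) m) as [|Hlt]; [assumption|exfalso].
  pose proof (acos_bound x). apply cos_decreasing_1 in Hlt; try lra.
  rewrite cos_acos in Hlt; lra.
Qed.

Lemma Cmod_sqr (z : C) : Cmod z ^ 2 = Re z ^ 2 + Im z ^ 2.
Proof.
  unfold Cmod, Re, Im. rewrite pow2_sqrt; [reflexivity|]. nra.
Qed.

Lemma Cmod_ratio_sqr (A : C) : 0 < Cmod A -> (Re A / Cmod A) ^ 2 + (Im A / Cmod A) ^ 2 = 1.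
Proof.
  intros H. unfold Rdiv. rewrite !Rpow_mult_distr, <- Rmult_plus_distr_r, <- Cmod_sqr.
  field. lra.
Qed.

Lemma carg_spec (A : C) : 0 < Cmod A ->
  Rabs (carg A) <= PI /\ cos (carg A) = Re A / Cmod A /\ sin (carg A) = Im A / Cmod A.
Proof.
  intros H. destruct (cos_sin_signed_acos (Re A / Cmod A) (Im A / Cmod A) (carg A))
    as [Habs Hcs].
  - now apply Cmod_ratio_sqr.
  - assert (HI : Im A = Im A / Cmod A * Cmod A) by (field; lra).
    unfold carg. destruct (Rle_dec 0 (Im A)); [left|right]; (split; [nra|reflexivity]).
  - split; [rewrite Habs; apply acos_bound|exact Hcs].
Qed.

(** * Lower bounds for horizontal curves *)

Lemma cauchy_schwarz3 (a b c x y z : R) :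
  (a * x + b * y + c * z) ^ 2 <= (a ^ 2 + b ^ 2 + c ^ 2) * (x ^ 2 + y ^ 2 + z ^ 2).
Proof.
  pose proof (pow2_ge_0 (a * y - b * x)). pose proof (pow2_ge_0 (a * z - c * x)).
  pose proof (pow2_ge_0 (b * z - c * y)). nra.
Qed.

(** The function is the real part of [(f + i g) exp (i k h)]. *)
Lemma is_derive_rotation (f g h : R -> R) (k t df dg dh : R) :
  is_derive f t df -> is_derive g t dg -> is_derive h t dh ->
  is_derive (fun t => f t * cos (k * h t) - g t * sin (k * h t)) t
    (df * cos (k * h t) - dg * sin (k * h t)
     - k * dh * (f t * sin (k * h t) + g t * cos (k * h t))).
Proof.
  intros Hf Hg Hh. auto_derive.
  - repeat split; eexists; eassumption.
  - rewrite (is_derive_unique (fun x : R => f x) _ _ Hf),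
      (is_derive_unique (fun x : R => g x) _ _ Hg),
      (is_derive_unique (fun x : R => h x) _ _ Hh). ring.
Qed.

Lemma continuous_sqr (f : R -> R) (t : R) :
  continuous f t -> continuous (fun s => f s ^ 2) t.
Proof.
  intros H. apply (continuous_comp f (fun s => s ^ 2)); [exact H|].
  apply (ex_derive_continuous (fun s => s ^ 2)). auto_derive. trivial.
Qed.

Section HorizontalCurve.
Variables (a b : R -> C) (v u1 u4 u2 : R -> R) (A B : C) (w : R).
Hypothesis Hadm : admissible a b v u1 u4 u2 A B w.

Definition plane_speed (t : R) : R := sqrt (u1 t ^ 2 + u2 t ^ 2).

Definition plane_length : R := RInt plane_speed 0 1.

Lemma continuous_plane_speed t : continuous plane_speed t.
Proof.
  destruct Hadm as [_ [Hc _]]. destruct (Hc t) as [H1 [_ H2]].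
  apply (continuous_sqrt_comp (fun t => u1 t ^ 2 + u2 t ^ 2)).
  apply (continuous_plus (fun t => u1 t ^ 2) (fun t => u2 t ^ 2)); now apply continuous_sqr.
Qed.

Lemma continuous_speed t : continuous (fun t => sqrt (u1 t ^ 2 + u4 t ^ 2 + u2 t ^ 2)) t.
Proof.
  destruct Hadm as [_ [Hc _]]. destruct (Hc t) as [H1 [H4 H2]].
  apply (continuous_sqrt_comp (fun t => u1 t ^ 2 + u4 t ^ 2 + u2 t ^ 2)).
  apply (continuous_plus (fun t => u1 t ^ 2 + u4 t ^ 2) (fun t => u2 t ^ 2));
    [|now apply continuous_sqr].
  apply (continuous_plus (fun t => u1 t ^ 2) (fun t => u4 t ^ 2)); now apply continuous_sqr.
Qed.

Lemma plane_length_ge0 : 0 <= plane_length.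
Proof.
  replace 0 with (RInt plane_speed 0 0) by apply (RInt_point 0 plane_speed).
  apply (derive_ge0_le (fun s => RInt plane_speed 0 s) plane_speed).
  - exact (is_derive_primitive _ continuous_plane_speed).
  - intros t. apply sqrt_pos.
Qed.

Lemma is_derive_re_a t :
  is_derive (fun s => Re (a s)) t (- (Re (b t) * u1 t + Im (b t) * u2 t) / 2).
Proof.
  destruct Hadm as [_ [_ [Hd _]]]. destruct (Hd t 0%nat 0%nat) as [H _]; [lia|lia|].
  evar_last; [exact H|]. unfold mat3mul, elt, hor, Re, Im; simpl. field.
Qed.

Lemma is_derive_im_a t :
  is_derive (fun s => Im (a s)) t ((Re (b t) * u2 t - Im (b t) * u1 t) / 2).
Proof.
  destruct Hadm as [_ [_ [Hd _]]]. destruct (Hd t 0%nat 0%nat) as [_ H]; [lia|lia|].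
  evar_last; [exact H|]. unfold mat3mul, elt, hor, Re, Im; simpl. field.
Qed.

(** The matrix equation gives the derivative of [exp (v s)] only; composing with [ln] recovers that
    of [v]. *)
Lemma is_derive_v t : is_derive v t (u4 t).
Proof.
  destruct Hadm as [_ [_ [Hd _]]]. destruct (Hd t 2%nat 2%nat) as [H _]; [lia|lia|].
  apply (is_derive_ext (fun s => ln (exp (v s)))).
  { intros s. apply ln_exp. }
  evar_last.
  - apply (is_derive_comp ln (fun s => exp (v s))); [|exact H].
    apply is_derive_Reals, derivable_pt_lim_ln, exp_pos.
  - unfold mat3mul, elt, hor, Re; simpl. unfold scal; simpl; unfold mult; simpl.
    field. apply Rgt_not_eq, exp_pos.
Qed.

(** The pair (arc length in SU(2), [v]) moves in the Euclidean plane with the speed of the curve and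
    ends at [(plane_length, w)]. *)
Lemma length_ge : sqrt (w ^ 2 + plane_length ^ 2) <= sr_length u1 u4 u2.
Proof.
  set (M := sqrt (w ^ 2 + plane_length ^ 2)).
  assert (HM0 : 0 <= M) by apply sqrt_pos.
  assert (HM2 : M ^ 2 = w ^ 2 + plane_length ^ 2) by (apply pow2_sqrt; nra).
  unfold sr_length. set (sp := fun t => sqrt (u1 t ^ 2 + u4 t ^ 2 + u2 t ^ 2)).
  assert (Hsp : forall t, 0 <= sp t) by (intros t; apply sqrt_pos).
  assert (HL : forall t, is_derive (fun s => RInt sp 0 s) t (sp t)).
  { exact (is_derive_primitive _ continuous_speed). }
  destruct Hadm as [_ [_ [_ [_ [_ [Hv0 [_ [_ Hv1]]]]]]]].
  (* The difference is nondecreasing by Cauchy-Schwarz; it is 0 at time 0 and [M] times the length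
     minus [M ^ 2] at time 1. *)
  assert (Hmon :
    M * RInt sp 0 0 - plane_length * RInt plane_speed 0 0 - w * v 0 <=
    M * RInt sp 0 1 - plane_length * RInt plane_speed 0 1 - w * v 1).
  { apply (derive_ge0_le
      (fun s => M * RInt sp 0 s - plane_length * RInt plane_speed 0 s - w * v s)
      (fun s => M * sp s - plane_length * plane_speed s - w * u4 s)).
    - intros t.
      apply (is_derive_minus (fun s => M * RInt sp 0 s - plane_length * RInt plane_speed 0 s)
               (fun s => w * v s)); [|apply is_derive_scal, is_derive_v].
      apply (is_derive_minus (fun s => M * RInt sp 0 s)
               (fun s => plane_length * RInt plane_speed 0 s));
        apply is_derive_scal; [apply HL|].
      apply (is_derive_primitive _ continuous_plane_speed).
    - intros t.
      assert (H2 : sp t ^ 2 = plane_speed t ^ 2 + u4 t ^ 2).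
      { unfold sp, plane_speed. rewrite !pow2_sqrt by nra. ring. }
      assert (plane_length * plane_speed t + w * u4 t <= M * sp t); [|lra].
      apply Rle_trans with (Rabs (plane_length * plane_speed t + w * u4 t)); [apply Rle_abs|].
      rewrite <- (Rabs_pos_eq (M * sp t)) by (apply Rmult_le_pos; auto).
      apply Rsqr_le_abs_0. unfold Rsqr.
      replace (M * sp t * (M * sp t)) with (M ^ 2 * sp t ^ 2) by ring.
      rewrite HM2, H2.
      pose proof (cauchy_schwarz3 plane_length w 0 (plane_speed t) (u4 t) 0). nra. }
  rewrite !(RInt_point 0) in Hmon. change zero with 0 in Hmon.
  fold plane_length in Hmon. rewrite Hv0, Hv1 in Hmon.
  destruct (Req_dec M 0) as [->|HM].
  - apply Rle_trans with (RInt sp 0 0); [right; symmetry; apply (RInt_point 0 sp)|].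
    apply (derive_ge0_le (fun s => RInt sp 0 s) sp); auto.
  - apply Rmult_le_reg_l with M; [lra|]. nra.
Qed.

(* [l] is strictly larger than half the length so that a phase [q] can be spread
   proportionally to [sg] below even along a constant curve, where arc length
   vanishes. *)
Lemma endpoint_ge (l q : R) :
  plane_length / 2 < l -> l ^ 2 + q ^ 2 <= PI ^ 2 ->
  cos (sqrt (l ^ 2 + q ^ 2)) <= Re A * cos q - Im A * sin q.
Proof.
  intros Hl HPI.
  set (P := fun s => RInt plane_speed 0 s).
  assert (HP : forall t, is_derive P t (plane_speed t)).
  { exact (is_derive_primitive _ continuous_plane_speed). }
  assert (HP0 : P 0 = 0) by apply (RInt_point 0 plane_speed).
  assert (HP1 : P 1 = plane_length) by reflexivity.
  clearbody P.
  pose proof plane_length_ge0 as HL0.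
  set (e := l - plane_length / 2).
  assert (Hl0 : 0 < l) by lra.
  (* Per unit of [sg], [k] is the phase added and [m] bounds the speed of the rotated curve on the
     sphere. *)
  set (k := q / l). set (m := sqrt (l ^ 2 + q ^ 2) / l).
  assert (Hm2 : m ^ 2 = 1 + k ^ 2).
  { unfold m, k. unfold Rdiv. rewrite Rpow_mult_distr, pow2_sqrt by nra. field. lra. }
  assert (Hm0 : 0 <= m).
  { apply Rmult_le_pos; [apply sqrt_pos|]. left. now apply Rinv_0_lt_compat. }
  (* The half is the one in [E1] and [E2]: speed on the unit sphere is half the sub-Riemannian
     speed. *)
  set (sg := fun t => P t / 2 + e * t).
  assert (Hsg : forall t, is_derive sg t (plane_speed t / 2 + e)).
  { intros t. unfold sg. auto_derive; [exists (plane_speed t); apply HP|].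
    rewrite (is_derive_unique (fun x : R => P x) _ _ (HP t)). field. }
  assert (Hsg0 : sg 0 = 0).
  { unfold sg. lra. }
  assert (Hsg1 : sg 1 = l).
  { unfold sg, e. lra. }
  clearbody sg.
  set (dsg := fun t => plane_speed t / 2 + e).
  set (c := fun t => cos (k * sg t)). set (s := fun t => sin (k * sg t)).
  set (y := fun t => Re (a t) * s t + Im (a t) * c t).
  set (dx := fun t => - (u1 t / 2 * (Re (b t) * c t - Im (b t) * s t)
                        + u2 t / 2 * (Im (b t) * c t + Re (b t) * s t) + k * dsg t * y t)).
  destruct Hadm as [Hin [_ [_ [Ha0 [_ [_ [Ha1 _]]]]]]].
  assert (Hcs : forall t, s t ^ 2 + c t ^ 2 = 1).
  { intros t. unfold s, c. rewrite <- !Rsqr_pow2. apply sin2_cos2. }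
  assert (Hn : forall t, Re (a t) ^ 2 + Im (a t) ^ 2 + Re (b t) ^ 2 + Im (b t) ^ 2 = 1).
  { intros t. generalize (Hin t). unfold in_G. rewrite !Cmod_sqr. lra. }
  (* [a] and [b], both multiplied by [exp (i k sg)], are still the coordinates of a point of the
     unit 3-sphere; three squares complement the first. *)
  assert (Hy : forall t, 1 - (Re (a t) * c t - Im (a t) * s t) ^ 2 =
    (Re (b t) * c t - Im (b t) * s t) ^ 2 + (Im (b t) * c t + Re (b t) * s t) ^ 2 + y t ^ 2).
  { intros t. unfold y.
    transitivity ((Re (b t) ^ 2 + Im (b t) ^ 2) * (s t ^ 2 + c t ^ 2)
      + (Re (a t) ^ 2 + Im (a t) ^ 2) * (s t ^ 2 + c t ^ 2)
      - (Re (a t) * c t - Im (a t) * s t) ^ 2).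
    - rewrite Hcs. specialize (Hn t). lra.
    - ring. }
  assert (Hmain : cos (m * sg 1) <= Re (a 1) * c 1 - Im (a 1) * s 1).
  { apply (cos_comparison (fun t => Re (a t) * c t - Im (a t) * s t) dx
             (fun t => m * sg t) (fun t => m * dsg t)).
    - intros t. evar_last.
      + apply (is_derive_rotation (fun t => Re (a t)) (fun t => Im (a t)) sg);
          [apply is_derive_re_a|apply is_derive_im_a|apply Hsg].
      + unfold dx, y, dsg, c, s. field.
    - intros t. apply is_derive_scal, Hsg.
    - intros t. apply Rmult_le_pos; [assumption|]. unfold dsg.
      pose proof (sqrt_pos (u1 t ^ 2 + u2 t ^ 2)) as H. fold (plane_speed t) in H.
      unfold e. lra.
    - intros t. specialize (Hy t). cbv beta.
      pose proof (pow2_ge_0 (Re (b t) * c t - Im (b t) * s t)).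
      pose proof (pow2_ge_0 (Im (b t) * c t + Re (b t) * s t)).
      pose proof (pow2_ge_0 (y t)). lra.
    (* [dx] is minus the inner product of [(u1 / 2, u2 / 2, k * dsg)] with the three remaining
       coordinates. *)
    - intros t. cbv beta. rewrite Hy. unfold dx.
      rewrite <- Rsqr_pow2, <- Rsqr_neg, Rsqr_pow2.
      eapply Rle_trans; [apply cauchy_schwarz3|].
      apply Rmult_le_compat_r.
      + apply Rplus_le_le_0_compat; [apply Rplus_le_le_0_compat|]; apply pow2_ge_0.
      + rewrite !Rpow_mult_distr, Hm2.
        assert (H : (u1 t / 2) ^ 2 + (u2 t / 2) ^ 2 <= dsg t ^ 2).
        { assert (Hs : plane_speed t ^ 2 = u1 t ^ 2 + u2 t ^ 2) by
            (apply pow2_sqrt; nra).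
          pose proof (sqrt_pos (u1 t ^ 2 + u2 t ^ 2)) as H. fold (plane_speed t) in H.
          unfold dsg. assert (0 < e) by (unfold e; lra). nra. }
        nra.
    - unfold c, s. rewrite Ha0, Hsg0, Rmult_0_r, cos_0, sin_0. simpl. ring.
    - rewrite Hsg0. ring.
    - rewrite Hsg1. unfold m. replace (sqrt (l ^ 2 + q ^ 2) / l * l) with (sqrt (l ^ 2 + q ^ 2))
        by (field; lra).
      rewrite <- (sqrt_pow2 PI) by (left; apply PI_RGT_0). now apply sqrt_le_1_alt. }
  unfold c, s in Hmain. rewrite Hsg1, Ha1 in Hmain.
  replace (m * l) with (sqrt (l ^ 2 + q ^ 2)) in Hmain by (unfold m; field; lra).
  replace (k * l) with q in Hmain by (unfold k; field; lra).
  exact Hmain.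
Qed.

End HorizontalCurve.

(** * Endpoints of normal geodesics and minimality *)

(** Only [A] is constrained: it fixes the modulus of [B], and the phase of [B] is adjusted by the
    initial direction of the geodesic. *)
Definition extremal (A : C) (th c s : R) : Prop :=
  c ^ 2 + s ^ 2 = 1 /\ 0 <= s /\ 0 <= th <= PI /\
  Re A = cos th * cos (c * th) + c * sin th * sin (c * th) /\
  Im A = c * sin th * cos (c * th) - cos th * sin (c * th).

Lemma extremal_rotate (A : C) (th c s : R) : extremal A th c s ->
  Re A * cos (c * th) - Im A * sin (c * th) = cos th /\
  Re A * sin (c * th) + Im A * cos (c * th) = c * sin th.
Proof.
  intros (_ & _ & _ & -> & ->).
  pose proof (sin2_cos2 (c * th)) as H. rewrite !Rsqr_pow2 in H.
  split.
  - transitivity (cos th * (sin (c * th) ^ 2 + cos (c * th) ^ 2)); [ring|rewrite H; ring].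
  - transitivity (c * sin th * (sin (c * th) ^ 2 + cos (c * th) ^ 2)); [ring|rewrite H; ring].
Qed.

(** On SU(2) the left-hand side is the squared modulus of [B]. *)
Lemma extremal_Cmod (A : C) (th c s : R) :
  extremal A th c s -> 1 - Cmod A ^ 2 = (s * sin th) ^ 2.
Proof.
  intros HE. destruct (extremal_rotate _ _ _ _ HE) as [H1 H2].
  destruct HE as [Hcs _]. rewrite Cmod_sqr.
  pose proof (sin2_cos2 (c * th)) as Hq. pose proof (sin2_cos2 th) as Hth.
  rewrite !Rsqr_pow2 in Hq, Hth.
  assert (Hn : Re A ^ 2 + Im A ^ 2 = cos th ^ 2 + (c * sin th) ^ 2).
  { rewrite <- H1, <- H2.
    transitivity ((Re A ^ 2 + Im A ^ 2) * (sin (c * th) ^ 2 + cos (c * th) ^ 2));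
      [rewrite Hq; ring|ring]. }
  rewrite Hn. replace (s ^ 2) with (1 - c ^ 2) by lra.
  rewrite !Rpow_mult_distr. replace (s ^ 2) with (1 - c ^ 2) by lra.
  replace (cos th ^ 2) with (1 - sin th ^ 2) by lra. ring.
Qed.

Lemma extremal_length_le (A B : C) (w th c s : R) a b v u1 u4 u2 :
  extremal A th c s -> admissible a b v u1 u4 u2 A B w ->
  sqrt (w ^ 2 + (2 * s * th) ^ 2) <= sr_length u1 u4 u2.
Proof.
  intros HE Hadm.
  apply Rle_trans with (2 := length_ge _ _ _ _ _ _ _ _ _ Hadm).
  apply sqrt_le_1_alt, Rplus_le_compat_l, pow_incr.
  pose proof (plane_length_ge0 _ _ _ _ _ _ _ _ _ Hadm) as HL0.
  destruct (extremal_rotate _ _ _ _ HE) as [H1 _].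
  destruct HE as (Hcs & Hs & Hth & _).
  split; [nra|].
  destruct (Rle_or_lt (2 * s * th) (plane_length u1 u2)) as [|Hlt]; [assumption|exfalso].
  (* The midpoint exceeds half the length, as the endpoint bound requires, and stays below [s * th];
     hence [sqrt (l ^ 2 + (c * th) ^ 2) < th], which contradicts that bound. *)
  set (l := (plane_length u1 u2 / 2 + s * th) / 2).
  assert (Hl : 0 <= l < s * th) by (unfold l; lra).
  assert (Hlt' : l ^ 2 + (c * th) ^ 2 < th ^ 2).
  { replace (th ^ 2) with ((s * th) ^ 2 + (c * th) ^ 2); [nra|].
    transitivity ((c ^ 2 + s ^ 2) * th ^ 2); [ring|rewrite Hcs; ring]. }
  assert (Hsq : sqrt (l ^ 2 + (c * th) ^ 2) < th).
  { apply Rlt_le_trans with (sqrt (th ^ 2)).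
    - apply sqrt_lt_1_alt. split; [nra|exact Hlt'].
    - rewrite sqrt_pow2; lra. }
  pose proof (endpoint_ge _ _ _ _ _ _ _ _ _ Hadm l (c * th)) as H.
  rewrite H1 in H.
  apply (Rlt_irrefl (cos th)). eapply Rlt_le_trans; [|apply H].
  - apply cos_decreasing_1; try lra.
    apply sqrt_pos.
  - unfold l. lra.
  - nra.
Qed.

(** The controls in the [E1], [E2] plane have constant norm [2 * s * th] and turn at the constant
    rate [2 * c * th], so the length integrand is constant. *)
Lemma extremal_curve (A B : C) (w th c s : R) :
  in_G A B w -> extremal A th c s ->
  exists a b v u1 u4 u2, admissible a b v u1 u4 u2 A B w /\
    sqrt (w ^ 2 + (2 * s * th) ^ 2) = sr_length u1 u4 u2.
Proof.
  intros HG HE.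
  pose proof (extremal_Cmod _ _ _ _ HE) as HB.
  assert (HB2 : Re B ^ 2 + Im B ^ 2 = (s * sin th) ^ 2).
  { rewrite <- HB, <- Cmod_sqr. unfold in_G in HG. lra. }
  (* [ph] is the initial angle of the controls; it is arbitrary when [B] vanishes. *)
  assert (Hph : exists ph, Re B = s * sin th * cos (c * th + ph) /\
                           Im B = s * sin th * sin (c * th + ph)).
  { set (m := s * sin th) in *.
    destruct (Req_dec m 0) as [->|Hm].
    - exists 0. assert (Re B = 0) by nra. assert (Im B = 0) by nra. lra.
    - destruct (exists_angle (Re B / m) (Im B / m)) as (t & _ & Hc & Hs).
      + unfold Rdiv. rewrite !Rpow_mult_distr, <- Rmult_plus_distr_r, HB2.
        field. assumption.
      + exists (t - c * th). replace (c * th + (t - c * th)) with t by ring.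
        rewrite Hc, Hs. split; field; assumption. }
  destruct Hph as [ph [HreB HimB]].
  destruct HE as (Hcs & Hs & Hth & HreA & HimA).
  exists
    (fun t => (cos (th * t) * cos (c * th * t) + c * sin (th * t) * sin (c * th * t),
               c * sin (th * t) * cos (c * th * t) - cos (th * t) * sin (c * th * t))),
    (fun t => (s * sin (th * t) * cos (c * th * t + ph),
               s * sin (th * t) * sin (c * th * t + ph))),
    (fun t => w * t),
    (fun t => 2 * s * th * cos (2 * (c * th * t) + ph)), (fun _ => w),
    (fun t => 2 * s * th * sin (2 * (c * th * t) + ph)).
  split.
  - split; [|split; [|split]].
    + intros t. unfold in_G. rewrite !Cmod_sqr. unfold Re, Im, fst, snd.
      pose proof (sin2_cos2 (th * t)) as H1.
      pose proof (sin2_cos2 (c * th * t)) as H2.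
      pose proof (sin2_cos2 (c * th * t + ph)) as H3.
      rewrite !Rsqr_pow2 in H1, H2, H3.
      transitivity ((cos (th * t) ^ 2 + c ^ 2 * sin (th * t) ^ 2)
          * (sin (c * th * t) ^ 2 + cos (c * th * t) ^ 2)
        + s ^ 2 * sin (th * t) ^ 2
          * (sin (c * th * t + ph) ^ 2 + cos (c * th * t + ph) ^ 2)); [ring|].
      rewrite H2, H3.
      transitivity (cos (th * t) ^ 2 + (c ^ 2 + s ^ 2) * sin (th * t) ^ 2); [ring|].
      rewrite Hcs. lra.
    + intros t. split; [|split].
      * apply (ex_derive_continuous (fun t => 2 * s * th * cos (2 * (c * th * t) + ph))).
        auto_derive. trivial.
      * apply continuous_const.
      * apply (ex_derive_continuous (fun t => 2 * s * th * sin (2 * (c * th * t) + ph))).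
        auto_derive. trivial.
    + intros t.
      (* Splitting the phase into [c * th * t] and [c * th * t + ph] turns the equations of motion
         into polynomial identities modulo Pythagorean relations. *)
      assert (Ec : cos (2 * (c * th * t) + ph) =
        cos (c * th * t) * cos (c * th * t + ph) - sin (c * th * t) * sin (c * th * t + ph)).
      { rewrite <- cos_plus. f_equal. ring. }
      assert (Es : sin (2 * (c * th * t) + ph) =
        sin (c * th * t) * cos (c * th * t + ph) + cos (c * th * t) * sin (c * th * t + ph)).
      { rewrite <- sin_plus. f_equal. ring. }
      pose proof (sin2_cos2 (c * th * t)) as H2.
      pose proof (sin2_cos2 (c * th * t + ph)) as H3.
      rewrite !Rsqr_pow2 in H2, H3.
      assert (Hs2 : s ^ 2 = 1 - c ^ 2) by lra.
      assert (Hq : sin (c * th * t) ^ 2 = 1 - cos (c * th * t) ^ 2) by lra.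
      assert (Hp : sin (c * th * t + ph) ^ 2 = 1 - cos (c * th * t + ph) ^ 2) by lra.
      assert (Hh : forall z, 2 * s * th * z / 2 = s * th * z) by (intros; field).
      assert (Hnh : forall z, - (2 * s * th * z) / 2 = - (s * th * z)) by (intros; field).
      intros i j Hi Hj.
      destruct i as [|[|[|i]]]; [| | |lia]; destruct j as [|[|[|j]]]; try lia;
      unfold mat3mul, elt, hor, Re, Im; simpl; rewrite ?Ec, ?Es; split;
      auto_derive; trivial; simpl; rewrite ?Hh, ?Hnh; ring [Hq Hp Hs2].
    + rewrite !Rmult_0_r, !Rmult_1_r, cos_0, sin_0.
      repeat split; trivial.
      * unfold RtoC. f_equal; ring.
      * unfold RtoC. f_equal; ring.
      * rewrite (surjective_pairing A). fold (Re A) (Im A). now rewrite HreA, HimA.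
      * rewrite (surjective_pairing B). fold (Re B) (Im B). now rewrite HreB, HimB.
  - unfold sr_length.
    rewrite (RInt_ext _ (fun _ => sqrt (w ^ 2 + (2 * s * th) ^ 2))).
    + rewrite RInt_const. unfold scal; simpl. unfold mult; simpl. ring.
    + intros t _. f_equal.
      pose proof (sin2_cos2 (2 * (c * th * t) + ph)) as H. rewrite !Rsqr_pow2 in H.
      transitivity (w ^ 2 + (2 * s * th) ^ 2 *
        (sin (2 * (c * th * t) + ph) ^ 2 + cos (2 * (c * th * t) + ph) ^ 2));
        [ring|rewrite H; ring].
Qed.

Lemma extremal_distance (A B : C) (w th c s : R) :
  in_G A B w -> extremal A th c s ->
  d2_from_Id A B w = Finite (sqrt (w ^ 2 + (2 * s * th) ^ 2)).
Proof.
  intros HG HE. apply is_glb_Rbar_unique. split.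
  - intros L (a & b & v & u1 & u4 & u2 & Hadm & ->). simpl.
    eapply extremal_length_le; eassumption.
  - intros L HL. apply HL.
    destruct (extremal_curve _ _ _ _ _ _ HG HE) as (a & b & v & u1 & u4 & u2 & H).
    now exists a, b, v, u1, u4, u2.
Qed.

(** * Uniqueness of the geodesic parameters *)

(** Combining the rotated equations for [c] and [- c] gives [Re A * cos (c * th) = cos th] and
    [Re A * sin (c * th) = c * sin th]. Eliminating [Re A] contradicts the decrease of [x cot x]
    between [c * th] and [th]. *)
Lemma extremal_opp (A : C) (th c s : R) :
  Cmod A < 1 -> extremal A th c s -> extremal A th (- c) s -> ~ 0 < c.
Proof.
  intros HA HE HE' Hc.
  pose proof (extremal_Cmod _ _ _ _ HE) as Hm.
  destruct (extremal_rotate _ _ _ _ HE) as [H1 H2].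
  destruct (extremal_rotate _ _ _ _ HE') as [H3 H4].
  rewrite Ropp_mult_distr_l_reverse, cos_neg, sin_neg in H3, H4.
  destruct HE as (Hcs & Hs & Hth & _).
  assert (Hsth : s * sin th <> 0).
  { intros H0. rewrite H0 in Hm. pose proof (Cmod_ge_0 A). nra. }
  assert (Hs0 : s <> 0) by (intros ->; apply Hsth; ring).
  assert (Hth0 : th <> 0) by (intros ->; apply Hsth; rewrite sin_0; ring).
  assert (Hth1 : th <> PI) by (intros ->; apply Hsth; rewrite sin_PI; ring).
  assert (Hc1 : c < 1) by nra.
  pose proof (mul_cos_sin_lt (c * th) th) as H.
  assert (Hre : Re A * cos (c * th) = cos th) by lra.
  assert (Him : Re A * sin (c * th) = c * sin th) by lra.
  assert (Heq : th * (cos th * sin (c * th)) = c * th * (cos (c * th) * sin th)).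
  { rewrite <- Hre.
    transitivity (th * cos (c * th) * (Re A * sin (c * th))); [ring|rewrite Him; ring]. }
  rewrite Heq in H. apply (Rlt_irrefl _ (H ltac:(nra) ltac:(lra))).
Qed.

(** The distance fixes [s * th] and the modulus of [A] fixes [s * sin th], which is positive since
    [Cmod A < 1]; so [sin th / th] is determined. *)
Lemma extremal_unique (A B : C) (w th1 c1 s1 th2 c2 s2 : R) :
  in_G A B w -> Cmod A < 1 -> extremal A th1 c1 s1 -> extremal A th2 c2 s2 ->
  c1 = c2 /\ s1 = s2.
Proof.
  intros HG HA HE1 HE2.
  pose proof (extremal_distance _ _ _ _ _ _ HG HE1) as HD.
  rewrite (extremal_distance _ _ _ _ _ _ HG HE2) in HD.
  injection HD as HD.
  apply sqrt_inj in HD; [|nra|nra].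
  pose proof (extremal_Cmod _ _ _ _ HE1) as Hm1.
  pose proof (extremal_Cmod _ _ _ _ HE2) as Hm2.
  assert (Hpos : 0 < 1 - Cmod A ^ 2) by (pose proof (Cmod_ge_0 A); nra).
  pose proof HE1 as (Hcs1 & Hs1 & Hth1 & _). pose proof HE2 as (Hcs2 & Hs2 & Hth2 & _).
  assert (Hsin1 : 0 <= sin th1) by (apply sin_ge_0; lra).
  assert (Hsin2 : 0 <= sin th2) by (apply sin_ge_0; lra).
  assert (Hl : s1 * th1 = s2 * th2).
  { assert (0 <= s1 * th1) by (apply Rmult_le_pos; lra).
    assert (0 <= s2 * th2) by (apply Rmult_le_pos; lra).
    apply Rsqr_inj; try assumption. unfold Rsqr. lra. }
  assert (Hss : s1 * sin th1 = s2 * sin th2).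
  { apply Rsqr_inj; try (apply Rmult_le_pos; assumption). unfold Rsqr. lra. }
  assert (Hp1 : 0 < s1 * sin th1) by (assert (0 <= s1 * sin th1) by (apply Rmult_le_pos; lra); nra).
  assert (Hs1' : 0 < s1) by nra. assert (Hs2' : 0 < s2) by nra.
  assert (Hn1 : th1 <> 0) by (intros ->; rewrite sin_0 in Hp1; lra).
  assert (Hn2 : th2 <> 0) by (intros ->; rewrite sin_0 in Hss; lra).
  assert (Heq : s1 * (th1 * sin th2) = s1 * (th2 * sin th1)).
  { transitivity ((s1 * th1) * sin th2); [ring|]. rewrite Hl.
    transitivity (th2 * (s2 * sin th2)); [ring|]. rewrite <- Hss. ring. }
  apply Rmult_eq_reg_l in Heq; [|lra].
  assert (Hth : th1 = th2).
  { destruct (Rtotal_order th1 th2) as [H|[H|H]]; [exfalso|assumption|exfalso].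
    - pose proof (sin_cross_lt th1 th2). lra.
    - pose proof (sin_cross_lt th2 th1). lra. }
  subst th2.
  assert (Hs : s1 = s2) by (apply Rmult_eq_reg_r with th1; assumption).
  split; [|assumption]. subst s2.
  assert (Hcc : (c1 - c2) * (c1 + c2) = 0) by lra.
  apply Rmult_integral in Hcc. destruct Hcc as [|Hcc]; [lra|].
  assert (c2 = - c1) as -> by lra.
  pose proof (extremal_opp _ _ _ _ HA HE1 HE2) as Ho1.
  rewrite <- (Ropp_involutive c1) in HE1.
  pose proof (extremal_opp _ _ _ _ HA HE2 HE1) as Ho2. lra.
Qed.

(** * The parameter [xi] and the two systems *)

Lemma sqrt_1_sqr_pos (xi : R) : 0 < sqrt (1 + xi ^ 2).
Proof. apply sqrt_lt_R0. nra. Qed.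

Lemma sqrt_1_sqr (xi : R) : sqrt (1 + xi ^ 2) ^ 2 = 1 + xi ^ 2.
Proof. apply pow2_sqrt. nra. Qed.

Lemma slope_sqr (xi : R) : (xi / sqrt (1 + xi ^ 2)) ^ 2 + (1 / sqrt (1 + xi ^ 2)) ^ 2 = 1.
Proof.
  pose proof (sqrt_1_sqr_pos xi) as Hk. unfold Rdiv. rewrite !Rpow_mult_distr.
  rewrite <- Rmult_plus_distr_r. replace (xi ^ 2 + 1 ^ 2) with (sqrt (1 + xi ^ 2) ^ 2)
    by (rewrite sqrt_1_sqr; ring).
  field. lra.
Qed.

Lemma slope_inj (x y : R) :
  x / sqrt (1 + x ^ 2) = y / sqrt (1 + y ^ 2) ->
  1 / sqrt (1 + x ^ 2) = 1 / sqrt (1 + y ^ 2) -> x = y.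
Proof.
  intros H1 H2. pose proof (sqrt_1_sqr_pos x). pose proof (sqrt_1_sqr_pos y).
  apply Rmult_eq_reg_r with (1 / sqrt (1 + y ^ 2));
    [|unfold Rdiv; rewrite Rmult_1_l; apply Rinv_neq_0_compat; lra].
  rewrite <- H2 at 1. unfold Rdiv in *. lra.
Qed.

Section Systems.
Variable A : C.
Hypothesis HA : 0 < Cmod A < 1.

(** In complex form, [Cmod A * exp (i T) = cos S + i c sin S] with [c = xi / sqrt (1 + xi ^ 2)]:
    this makes [T] the argument of the second factor of an extremal with [th = S]. *)
Lemma S_T_triangle (xi : R) : xi_dom A xi ->
  0 <= S A xi <= PI / 2 /\
  Cmod A * cos (T A xi) = cos (S A xi) /\
  Cmod A * sin (T A xi) = xi / sqrt (1 + xi ^ 2) * sin (S A xi).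
Proof.
  intros Hd. unfold xi_dom in Hd. unfold S, T.
  set (r := Cmod A) in *. set (n := sqrt (1 - r ^ 2)).
  assert (Hn2 : n ^ 2 = 1 - r ^ 2) by (apply pow2_sqrt; nra).
  assert (Hn : 0 < n) by (apply sqrt_lt_R0; nra).
  pose proof (sqrt_1_sqr_pos xi) as Hk. pose proof (sqrt_1_sqr xi) as Hk2.
  rewrite sqrt_mult by nra. fold n. set (k := sqrt (1 + xi ^ 2)) in *.
  assert (Hnk : 0 < n * k) by (apply Rmult_lt_0_compat; assumption).
  assert (Hnk1 : n * k <= 1).
  { apply Rsqr_incr_0_var; [|lra]. unfold Rsqr.
    replace (n * k * (n * k)) with (n ^ 2 * k ^ 2) by ring. rewrite Hn2, Hk2. nra. }
  assert (Hx : -1 <= xi * n / r <= 1).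
  { apply Rabs_le_between. rewrite <- Rabs_R1. apply Rsqr_le_abs_0. unfold Rsqr.
    replace (xi * n / r * (xi * n / r)) with (xi ^ 2 * n ^ 2 * / (r ^ 2)) by (field; lra).
    rewrite Hn2. apply Rmult_le_reg_r with (r ^ 2); [nra|].
    rewrite Rmult_assoc, Rinv_l by nra. lra. }
  rewrite !cos_asin, !sin_asin by lra.
  split; [|split].
  - split; [|apply asin_bound]. rewrite <- asin_0.
    destruct (Rle_or_lt (asin 0) (asin (n * k))) as [|Hlt]; [assumption|exfalso].
    pose proof (asin_bound (n * k)). pose proof (asin_bound 0).
    apply sin_increasing_1 in Hlt; try lra. rewrite !sin_asin in Hlt; lra.
  - rewrite <- (sqrt_pow2 r) at 1 by lra. rewrite <- sqrt_mult_alt by nra.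
    f_equal. unfold Rsqr.
    replace (n * k * (n * k)) with (n ^ 2 * k ^ 2) by ring.
    replace (r ^ 2 * (1 - xi * n / r * (xi * n / r))) with (r ^ 2 - xi ^ 2 * n ^ 2) by (field; lra).
    rewrite Hn2, Hk2. ring.
  - field. lra.
Qed.

Lemma sys4_extremal (xi : R) : sys4 A xi ->
  extremal A (S A xi) (xi / sqrt (1 + xi ^ 2)) (1 / sqrt (1 + xi ^ 2)).
Proof.
  intros (Hd & Hcos & Hsin).
  destruct (S_T_triangle xi Hd) as (HS & Hc & Hs).
  pose proof (sqrt_1_sqr_pos xi) as Hk.
  unfold extremal. split; [apply slope_sqr|].
  set (c := xi / sqrt (1 + xi ^ 2)) in *.
  rewrite Ropp_mult_distr_l_reverse, cos_plus, cos_neg, sin_neg in Hcos.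
  rewrite Ropp_mult_distr_l_reverse, sin_plus, cos_neg, sin_neg in Hsin.
  split; [left; apply Rdiv_lt_0_compat; lra|]. split; [lra|].
  rewrite <- Hc, <- Hs. split.
  - replace (Re A) with (Cmod A * (Re A / Cmod A)) by (field; lra). rewrite <- Hcos. ring.
  - replace (Im A) with (Cmod A * (Im A / Cmod A)) by (field; lra). rewrite <- Hsin. ring.
Qed.

(** With [th = PI - S], [cos th + i c sin th = - Cmod A * exp (- i T)]; hence the minus sign in the
    cosine equation. *)
Lemma sys5_extremal (xi : R) : sys5 A xi ->
  extremal A (PI - S A xi) (xi / sqrt (1 + xi ^ 2)) (1 / sqrt (1 + xi ^ 2)).
Proof.
  intros (Hd & Hcos & Hsin).
  destruct (S_T_triangle xi Hd) as (HS & Hc & Hs).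
  pose proof (sqrt_1_sqr_pos xi) as Hk.
  unfold extremal. split; [apply slope_sqr|].
  set (c := xi / sqrt (1 + xi ^ 2)) in *.
  rewrite cos_plus in Hcos. rewrite sin_plus in Hsin.
  split; [left; apply Rdiv_lt_0_compat; lra|]. split; [lra|].
  rewrite sin_PI_x, Rtrigo_facts.cos_pi_minus, <- Hc, <- Hs. split.
  - replace (Re A) with (- (Cmod A * - (Re A / Cmod A))) by (field; lra).
    rewrite <- Hcos. ring.
  - replace (Im A) with (Cmod A * (Im A / Cmod A)) by (field; lra). rewrite <- Hsin. ring.
Qed.

(* Parametrizing by [tau = T A xi] rather than by [xi] avoids the endpoints of the
   domain of [asin]. *)
Definition xi_of (tau : R) : R := Cmod A * sin tau / sqrt (1 - Cmod A ^ 2).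

Lemma xi_of_spec (tau : R) : - (PI / 2) <= tau <= PI / 2 ->
  xi_dom A (xi_of tau) /\ T A (xi_of tau) = tau /\
  S A (xi_of tau) = acos (Cmod A * cos tau).
Proof.
  intros Ht. unfold xi_dom, T, S, xi_of. set (r := Cmod A) in *.
  set (n := sqrt (1 - r ^ 2)).
  assert (Hn2 : n ^ 2 = 1 - r ^ 2) by (apply pow2_sqrt; nra).
  assert (Hn : 0 < n) by (apply sqrt_lt_R0; nra).
  pose proof (sin2_cos2 tau) as Hsc. rewrite !Rsqr_pow2 in Hsc.
  pose proof (cos_ge_0 tau ltac:(lra) ltac:(lra)) as Hc.
  rewrite <- Hn2. split; [|split].
  - replace ((r * sin tau / n) ^ 2 * n ^ 2) with (r ^ 2 * sin tau ^ 2) by (field; lra).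
    nra.
  - replace (r * sin tau / n * n / r) with (sin tau) by (field; lra).
    now apply asin_sin.
  - assert (Hrc : 0 <= r * cos tau < 1) by (pose proof (COS_bound tau); nra).
    replace (n ^ 2 * (1 + (r * sin tau / n) ^ 2)) with (n ^ 2 + r ^ 2 * sin tau ^ 2)
      by (field; lra).
    replace (n ^ 2 + r ^ 2 * sin tau ^ 2) with (1 - Rsqr (r * cos tau)).
    + rewrite <- sin_acos by lra. apply asin_sin.
      split; [pose proof (acos_bound (r * cos tau)); pose proof PI_RGT_0; lra|].
      rewrite <- acos_0.
      destruct (Rle_or_lt (acos (r * cos tau)) (acos 0)) as [|Hlt]; [assumption|exfalso].
      pose proof (acos_bound (r * cos tau)). pose proof (acos_bound 0).
      apply cos_decreasing_1 in Hlt; try lra. rewrite !cos_acos in Hlt; lra.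
    + rewrite Hn2. unfold Rsqr. replace (sin tau ^ 2) with (1 - cos tau ^ 2) by lra. ring.
Qed.

(** One statement for both systems: [e = 0] gives the phase of [sys4] and [e = PI] that of [sys5].
    The bounds are the values at [tau = - PI / 2] and [tau = PI / 2]. *)
Lemma exists_xi (e alpha : R) :
  - (PI / 2 + Cmod A * (e - PI / 2)) <= alpha <= PI / 2 + Cmod A * (e - PI / 2) ->
  exists xi, xi_dom A xi /\ xi / sqrt (1 + xi ^ 2) * (e - S A xi) + T A xi = alpha.
Proof.
  intros Hal.
  set (g := fun tau => xi_of tau / sqrt (1 + xi_of tau ^ 2) * (e - acos (Cmod A * cos tau)) + tau).
  assert (Hn : 0 < sqrt (1 - Cmod A ^ 2)) by (apply sqrt_lt_R0; nra).
  assert (Hcont : continuity g).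
  { intros tau. apply continuity_pt_filterlim. unfold g.
    apply (continuous_plus (fun tau => xi_of tau / sqrt (1 + xi_of tau ^ 2)
      * (e - acos (Cmod A * cos tau))) (fun tau => tau)); [|apply continuous_id].
    apply (continuous_mult (fun tau => xi_of tau / sqrt (1 + xi_of tau ^ 2))
      (fun tau => e - acos (Cmod A * cos tau))).
    - apply (continuous_comp xi_of (fun xi => xi / sqrt (1 + xi ^ 2))).
      + apply (ex_derive_continuous xi_of). unfold xi_of. auto_derive. trivial.
      + apply (ex_derive_continuous (fun xi => xi / sqrt (1 + xi ^ 2))). auto_derive.
        pose proof (sqrt_1_sqr_pos (xi_of tau)) as H. simpl in H.
        split; [nra|]. split; [lra|trivial].
    - apply (continuous_minus (fun _ => e) (fun tau => acos (Cmod A * cos tau)));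
        [apply continuous_const|].
      apply (continuous_comp (fun tau => Cmod A * cos tau) acos).
      + apply (ex_derive_continuous (fun tau => Cmod A * cos tau)). auto_derive. trivial.
      + apply continuous_acos. pose proof (COS_bound tau). nra. }
  (* With [y = sin tau] at the endpoints, the slope [c] there is [Cmod A] up to sign. *)
  assert (Hk : forall y, y ^ 2 = 1 ->
    Cmod A * y / sqrt (1 - Cmod A ^ 2) / sqrt (1 + (Cmod A * y / sqrt (1 - Cmod A ^ 2)) ^ 2)
    = Cmod A * y).
  { intros y Hy.
    assert (Hn2 : sqrt (1 - Cmod A ^ 2) ^ 2 = 1 - Cmod A ^ 2) by (apply pow2_sqrt; nra).
    set (n := sqrt (1 - Cmod A ^ 2)) in *.
    replace (sqrt (1 + (Cmod A * y / n) ^ 2)) with (/ n); [field; lra|].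
    symmetry. apply sqrt_lem_1.
    - nra.
    - left. now apply Rinv_0_lt_compat.
    - replace (1 + (Cmod A * y / n) ^ 2) with ((n ^ 2 + Cmod A ^ 2 * y ^ 2) / n ^ 2)
        by (field; lra).
      rewrite Hy, Hn2 at 1. replace (1 - Cmod A ^ 2 + Cmod A ^ 2 * 1) with 1 by ring. field. lra. }
  assert (Hg1 : g (PI / 2) = PI / 2 + Cmod A * (e - PI / 2)).
  { unfold g, xi_of. rewrite sin_PI2, cos_PI2, Rmult_0_r, acos_0, Hk by ring. ring. }
  assert (Hg2 : g (- (PI / 2)) = - (PI / 2 + Cmod A * (e - PI / 2))).
  { unfold g, xi_of.
    rewrite sin_neg, cos_neg, sin_PI2, cos_PI2, Rmult_0_r, acos_0, Hk by ring. ring. }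
  destruct (IVT_gen g (- (PI / 2)) (PI / 2) alpha Hcont) as [tau [Ht Heq]].
  { rewrite Hg1, Hg2, Rmin_left, Rmax_right by lra. exact Hal. }
  pose proof PI_RGT_0. rewrite Rmin_left, Rmax_right in Ht by lra.
  destruct (xi_of_spec tau Ht) as (Hd & HT & HS).
  exists (xi_of tau). split; [exact Hd|]. now rewrite HT, HS.
Qed.

End Systems.

(** * The five cases of the distance formula *)

Theorem theorem6 (A B : C) (v : R) (hG : in_G A B v) :
  (A = RtoC 0 -> d2_from_Id A B v = Finite (sqrt (v ^ 2 + PI ^ 2))) /\
  (Cmod A = 1 -> d2_from_Id A B v =
     Finite (sqrt (v ^ 2 + 4 * Rabs (carg A) * (2 * PI - Rabs (carg A))))) /\
  (0 < Cmod A < 1 -> Re A = Cmod A * sin (PI / 2 * Cmod A) ->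
     d2_from_Id A B v = Finite (sqrt (v ^ 2 + PI ^ 2 * (1 - Cmod A ^ 2)))) /\
  (0 < Cmod A < 1 -> Re A > Cmod A * sin (PI / 2 * Cmod A) ->
     (exists! xi, sys4 A xi) /\
     forall xi, sys4 A xi ->
       d2_from_Id A B v =
       Finite (sqrt (v ^ 2 + 4 / (1 + xi ^ 2) * (S A xi) ^ 2))) /\
  (0 < Cmod A < 1 -> Re A < Cmod A * sin (PI / 2 * Cmod A) ->
     (exists! xi, sys5 A xi) /\
     forall xi, sys5 A xi ->
       d2_from_Id A B v =
       Finite (sqrt (v ^ 2 + 4 / (1 + xi ^ 2) * (PI - S A xi) ^ 2))).
Proof.
  pose proof PI_RGT_0 as HPI.
  split; [|split; [|split; [|split]]].
  - intros HA. rewrite (extremal_distance A B v (PI / 2) 0 1 hG).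
    + do 3 f_equal. field.
    + rewrite HA. unfold extremal, Re, Im, RtoC. cbn [fst snd].
      rewrite Rmult_0_l, cos_PI2, sin_0.
      split; [|split; [|split; [|split]]]; lra.
  - intros HA.
    destruct (carg_spec A) as (Hph & Hc & Hs); [lra|].
    rewrite HA, Rdiv_1_r in Hc, Hs.
    (* For [th = PI] the endpoint is [A = - exp (- i q)] with [q = c * PI]. *)
    assert (Hq : exists q, Re A = - cos q /\ Im A = sin q /\
                           q ^ 2 = (PI - Rabs (carg A)) ^ 2).
    { destruct (Rle_or_lt 0 (carg A)) as [H|H].
      - exists (PI - carg A). rewrite (Rabs_pos_eq (carg A)) by lra.
        rewrite Rtrigo_facts.cos_pi_minus, sin_PI_x. lra.
      - exists (- (PI + carg A)). rewrite (Rabs_left (carg A)) by lra.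
        rewrite cos_neg, sin_neg, Rtrigo_facts.cos_pi_plus, Rtrigo_facts.sin_pi_plus.
        split; [|split]; [lra|lra|ring]. }
    destruct Hq as (q & HreA & HimA & Hq).
    pose proof (Rabs_pos (carg A)) as Hph0.
    assert (Hq1 : 0 <= 1 - (q / PI) ^ 2).
    { unfold Rdiv. rewrite Rpow_mult_distr, Hq.
      apply Rmult_le_reg_r with (PI ^ 2); [nra|].
      replace ((1 - (PI - Rabs (carg A)) ^ 2 * (/ PI) ^ 2) * PI ^ 2)
        with (PI ^ 2 - (PI - Rabs (carg A)) ^ 2) by (field; lra). nra. }
    rewrite (extremal_distance A B v PI (q / PI) (sqrt (1 - (q / PI) ^ 2)) hG).
    + do 3 f_equal. rewrite !Rpow_mult_distr, pow2_sqrt by assumption.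
      replace (2 ^ 2 * (1 - (q / PI) ^ 2) * PI ^ 2) with (4 * (PI ^ 2 - q ^ 2)) by (field; lra).
      rewrite Hq. ring.
    + unfold extremal. rewrite pow2_sqrt by assumption.
      replace (q / PI * PI) with q by (field; lra). rewrite cos_PI, sin_PI.
      split; [ring|]. split; [apply sqrt_pos|]. lra.
  - intros HA HreA.
    pose proof (sin2_cos2 (PI / 2 * Cmod A)) as Hsc. rewrite !Rsqr_pow2 in Hsc.
    (* For [th = PI / 2] the endpoint is [A = i c exp (- i c PI / 2)]. The modulus and [Re A] leave
       [Im A] free up to sign, and that sign selects [c]. *)
    assert (Hc : exists c, c ^ 2 = Cmod A ^ 2 /\ Re A = c * sin (c * (PI / 2)) /\
                           Im A = c * cos (c * (PI / 2))).
    { assert (HI : (Im A - Cmod A * cos (PI / 2 * Cmod A))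
                   * (Im A + Cmod A * cos (PI / 2 * Cmod A)) = 0).
      { pose proof (Cmod_sqr A) as H. rewrite HreA in H at 1.
        replace (Cmod A ^ 2) with
          (Cmod A ^ 2 * (sin (PI / 2 * Cmod A) ^ 2 + cos (PI / 2 * Cmod A) ^ 2)) in H
          by (rewrite Hsc; ring). nra. }
      apply Rmult_integral in HI. rewrite (Rmult_comm (PI / 2)) in HI, HreA.
      destruct HI as [HI|HI].
      - exists (Cmod A). split; [reflexivity|]. lra.
      - exists (- Cmod A). replace (- Cmod A * (PI / 2)) with (- (Cmod A * (PI / 2))) by ring.
        rewrite cos_neg, sin_neg. split; [ring|]. lra. }
    destruct Hc as (c & Hc2 & HreA' & HimA).
    assert (H1 : 0 <= 1 - c ^ 2) by nra.
    rewrite (extremal_distance A B v (PI / 2) c (sqrt (1 - c ^ 2)) hG).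
    + do 3 f_equal. rewrite !Rpow_mult_distr, pow2_sqrt by assumption.
      rewrite Hc2. field.
    + unfold extremal. rewrite pow2_sqrt by assumption. rewrite cos_PI2, sin_PI2.
      split; [ring|]. split; [apply sqrt_pos|]. lra.
  - intros HA HreA. split.
    (* The hypothesis says exactly that the argument of [A] lies strictly inside the range of phases
       for [e = 0], since [cos (PI / 2 - x) = sin x]. *)
    + destruct (exists_angle_le (Re A / Cmod A) (Im A / Cmod A) (PI / 2 + Cmod A * (0 - PI / 2)))
        as (al & Hal & Hcos & Hsin).
      * apply Cmod_ratio_sqr; lra.
      * nra.
      * replace (PI / 2 + Cmod A * (0 - PI / 2)) with (PI / 2 - PI / 2 * Cmod A) by ring.
        rewrite cos_shift. apply Rmult_lt_reg_r with (Cmod A); [lra|].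
        unfold Rdiv at 2. rewrite Rmult_assoc, Rinv_l by lra. lra.
      * destruct (exists_xi A HA 0 al Hal) as (xi & Hd & Hxi).
        assert (Hsys : sys4 A xi).
        { unfold sys4.
          replace (- (xi / sqrt (1 + xi ^ 2)) * S A xi + T A xi) with al
            by (rewrite <- Hxi; ring). auto. }
        exists xi. split; [exact Hsys|]. intros xi' Hxi'.
        destruct (extremal_unique _ _ _ _ _ _ _ _ _ hG (proj2 HA)
          (sys4_extremal A HA xi Hsys) (sys4_extremal A HA xi' Hxi')).
        now apply slope_inj.
    + intros xi Hxi. pose proof (sqrt_1_sqr_pos xi).
      rewrite (extremal_distance _ _ _ _ _ _ hG (sys4_extremal A HA xi Hxi)).
      do 3 f_equal. rewrite <- (sqrt_1_sqr xi) at 2. field. lra.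
  - intros HA HreA. split.
    (* Likewise for [e = PI], with [cos (PI / 2 + x) = - sin x]. *)
    + destruct (exists_angle_le (- (Re A / Cmod A)) (Im A / Cmod A)
                 (PI / 2 + Cmod A * (PI - PI / 2)))
        as (al & Hal & Hcos & Hsin).
      * rewrite <- (Cmod_ratio_sqr A) by lra. ring.
      * nra.
      * replace (PI / 2 + Cmod A * (PI - PI / 2)) with (PI / 2 + PI / 2 * Cmod A) by field.
        rewrite cos_plus, cos_PI2, sin_PI2.
        assert (Re A / Cmod A < sin (PI / 2 * Cmod A)); [|lra].
        apply Rmult_lt_reg_r with (Cmod A); [lra|].
        unfold Rdiv at 1. rewrite Rmult_assoc, Rinv_l by lra. lra.
      * destruct (exists_xi A HA PI al Hal) as (xi & Hd & Hxi).
        assert (Hsys : sys5 A xi) by (unfold sys5; rewrite Hxi; auto).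
        exists xi. split; [exact Hsys|]. intros xi' Hxi'.
        destruct (extremal_unique _ _ _ _ _ _ _ _ _ hG (proj2 HA)
          (sys5_extremal A HA xi Hsys) (sys5_extremal A HA xi' Hxi')).
        now apply slope_inj.
    + intros xi Hxi. pose proof (sqrt_1_sqr_pos xi).
      rewrite (extremal_distance _ _ _ _ _ _ hG (sys5_extremal A HA xi Hxi)).
      do 3 f_equal. rewrite <- (sqrt_1_sqr xi) at 2. field. lra.
Qed.
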